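(* Let $p\ge 3$ be an odd integer and let $\widehat{\mathcal T}:=\mathcal T+\mathcal E\in\bigotimes^p\mathbb R^n$, where $\mathcal T$ is a symmetric tensor with orthogonal decomposition $\mathcal T=\sum_{i=1}^n\lambda_i\,\boldsymbol v_i^{\otimes p}$, $\{\boldsymbol v_1,\dots,\boldsymbol v_n\}$ is an orthonormal basis of $\mathbb R^n$, $\lambda_i>0$ for all $i\in[n]$, and $\mathcal E$ is a symmetric tensor with operator norm $\varepsilon:=\|\mathcal E\|$. Let $\hat{\boldsymbol x}\in\arg\max_{\|\boldsymbol x\|_2=1}\widehat{\mathcal T}\boldsymbol x^{\otimes p}$ and $\hat\lambda:=\widehat{\mathcal T}\hat{\boldsymbol x}^{\otimes p}$. Then there exists $j\in[n]$ such that $$|\hat\lambda-\lambda_j|\le\varepsilon\qquad\text{and}\qquad\|\hat{\boldsymbol x}-\boldsymbol v_j\|_2\le 10\left(\frac{\varepsilon}{\lambda_j}+\left(\frac{\varepsilon}{\lambda_j}\right)^2\right).$$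
   Context: Notation: $[n]:=\{1,\dots,n\}$. $\bigotimes^p\mathbb R^n:=\mathbb R^{n\times\cdots\times n}$ ($p$ factors) is the space of real $p$-th order $n$-dimensional tensors. A tensor $\mathcal A=(\mathcal A_{i_1,\dots,i_p})$ is symmetric if its entries are invariant under every permutation of their indices. For $\boldsymbol v\in\mathbb R^n$, $\boldsymbol v^{\otimes p}$ is the tensor with entries $(\boldsymbol v^{\otimes p})_{i_1,\dots,i_p}=v_{i_1}\cdots v_{i_p}$. For vectors $\boldsymbol x_1,\dots,\boldsymbol x_p\in\mathbb R^n$, $\mathcal A(\boldsymbol x_1,\dots,\boldsymbol x_p):=\sum_{i_1,\dots,i_p\in[n]}\mathcal A_{i_1,\dots,i_p}(\boldsymbol x_1)_{i_1}\cdots(\boldsymbol x_p)_{i_p}$, and $\mathcal A\boldsymbol x^{\otimes p}:=\mathcal A(\boldsymbol x,\dots,\boldsymbol x)$. The operator norm is $\|\mathcal A\|:=\max_{\|\boldsymbol x_1\|=\cdots=\|\boldsymbol x_p\|=1}\mathcal A(\boldsymbol x_1,\dots,\boldsymbol x_p)$. On vectors, $\|\cdot\|=\|\cdot\|_2$ is the Euclidean norm. *)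

(* Defs.v *)
From mathcomp Require Import all_boot all_order all_fingroup all_algebra.
From mathcomp Require Import all_classical all_reals.

Set Implicit Arguments.
Unset Strict Implicit.
Unset Printing Implicit Defensive.

Import Order.TTheory GRing.Theory Num.Theory.

Local Open Scope classical_set_scope.
Local Open Scope ring_scope.

(* The codomain is [R^o] (convertible to [R]) so that tensors carry the
   pointwise [lmodType R] structure of finite functions. *)
Notation tensor R p n := {ffun {ffun 'I_p -> 'I_n} -> R^o}.

Definition tensor_pow (R : realType) (p n : nat) (v : 'rV[R]_n) :
    tensor R p n :=
  [ffun i : {ffun 'I_p -> 'I_n} => \prod_(k < p) v 0 (i k) : R^o].

Definition symmetric_tensor (R : realType) (p n : nat) (A : tensor R p n) :
    Prop :=
  forall (s : 'S_p) (i : {ffun 'I_p -> 'I_n}),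
    A [ffun k => i (s k)] = A i.

Definition tensor_form (R : realType) (p n : nat) (A : tensor R p n)
    (x : 'I_p -> 'rV[R]_n) : R :=
  \sum_(i : {ffun 'I_p -> 'I_n}) A i * \prod_(k < p) x k 0 (i k).

Definition tensor_diag (R : realType) (p n : nat) (A : tensor R p n)
    (x : 'rV[R]_n) : R :=
  tensor_form A (fun _ => x).

Definition dotp (R : realType) (n : nat) (u v : 'rV[R]_n) : R :=
  \sum_(i < n) u 0 i * v 0 i.

(* MathComp-Analysis equips ['rV[R]_n] with the sup norm, hence this separate
   Euclidean norm. *)
Definition norm2 (R : realType) (n : nat) (x : 'rV[R]_n) : R :=
  Num.sqrt (dotp x x).

Definition unit_sphere (R : realType) (n : nat) : set 'rV[R]_n :=
  [set x | norm2 x = 1].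

(* For n > 0 the supremum is over a compact nonempty set, hence it is the
   maximum; for n = 0 and p > 0 the sphere is empty and the value is the
   default [sup set0 = 0]. *)
Definition opnorm (R : realType) (p n : nat) (A : tensor R p n) : R :=
  sup [set tensor_form A x | x in
        [set x : 'I_p -> 'rV[R]_n | forall k, unit_sphere (x k)]].

Definition orthonormal_basis (R : realType) (n : nat) (v : 'I_n -> 'rV[R]_n) :
    Prop :=
  (forall i j, dotp (v i) (v j) = (i == j)%:R) /\
  basis_of fullv [seq v i | i <- enum 'I_n].

Definition argmax (R : realType) (X : Type) (D : set X) (f : X -> R) : set X :=
  [set x | D x /\ forall y, D y -> f y <= f x].

(* Main.v *)
Require Import Defs.
From mathcomp Require Import all_boot all_order all_fingroup all_algebra.
From mathcomp Require Import all_classical all_reals.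
From mathcomp Require Import ring lra.

Set Implicit Arguments.
Unset Strict Implicit.
Unset Printing Implicit Defensive.

Import Order.TTheory GRing.Theory Num.Theory.

Local Open Scope classical_set_scope.
Local Open Scope ring_scope.

(** Write [c i] for the coordinates of the maximizer [x] in the basis [v] and
    [m = p - 2], which is odd. The value of [T] at [x] is the average, with
    weights [c i ^+ 2] of total mass 1, of the numbers [lambda i * c i ^+ m].
    Let [j] maximize [lambda i * c i ^+ m] and [q = c j ^+ m]. Since [E]
    changes values on the sphere by at most [eps] ([tensor_form_norm_le]),
    comparing the maximizer with each [v i] gives
      [lambda i - eps <= lambdahat <= lambda j * q + eps]   for every [i].
    As [q <= 1], this is the eigenvalue bound. As [m] is odd and [|c j| <= 1],
    it also gives [c j >= q >= 1 - 2 * eps / lambda j] once the right side is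
    positive, hence an error [norm2 (x - v j)] of order the square root of
    [eps / lambda j].

    The linear rate comes from the first-order condition at the maximum
    ([argmax_stationary]), tested on the tangent vector [w = v j - c j *: x],
    of length [s] with [s ^+ 2 = 1 - c j ^+ 2]. Every [i != j] has
    [|c i| <= s], so that the other components contribute at most
    [(lambda j * q + 2 * eps) * s] in place of [lambda j * q], and stationarity
    yields
      [c j * s ^+ 2 * (lambda j * q - (lambda j * q + 2 * eps) * s) <= eps * s].
    When [eps / lambda j] is small, the square-root bound makes [s] small, the
    bracket is comparable to [lambda j], and [s] is bounded by a multiple of
    [eps / lambda j]. When [eps / lambda j] is not small, the square-root bound
    or the diameter of the sphere is already enough ([chord_le_of_stationary]).
*)

(** * Euclidean geometry of row vectors *)

Lemma dotpC (R : realType) (n : nat) (u v : 'rV[R]_n) : dotp u v = dotp v u.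
Proof. by apply: eq_bigr => i _; rewrite mulrC. Qed.

Lemma dotpDl (R : realType) (n : nat) (u v w : 'rV[R]_n) :
  dotp (u + v) w = dotp u w + dotp v w.
Proof. by rewrite -big_split; apply: eq_bigr => i _; rewrite !mxE mulrDl. Qed.

Lemma dotpZl (R : realType) (n : nat) (a : R) (u v : 'rV[R]_n) :
  dotp (a *: u) v = a * dotp u v.
Proof.
by rewrite /dotp mulr_sumr; apply: eq_bigr => i _; rewrite !mxE mulrA.
Qed.

Lemma dotpBl (R : realType) (n : nat) (u v w : 'rV[R]_n) :
  dotp (u - v) w = dotp u w - dotp v w.
Proof. by rewrite dotpDl -scaleN1r dotpZl mulN1r. Qed.

Lemma dotpBr (R : realType) (n : nat) (u v w : 'rV[R]_n) :
  dotp w (u - v) = dotp w u - dotp w v.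
Proof. by rewrite dotpC dotpBl !(dotpC w). Qed.

Lemma dotpZr (R : realType) (n : nat) (a : R) (u v : 'rV[R]_n) :
  dotp u (a *: v) = a * dotp u v.
Proof. by rewrite dotpC dotpZl dotpC. Qed.

Lemma dotp_ge0 (R : realType) (n : nat) (u : 'rV[R]_n) : 0 <= dotp u u.
Proof. by apply: sumr_ge0 => i _; rewrite -expr2 sqr_ge0. Qed.

Lemma norm2_ge0 (R : realType) (n : nat) (u : 'rV[R]_n) : 0 <= norm2 u.
Proof. exact: sqrtr_ge0. Qed.

Lemma sqr_norm2 (R : realType) (n : nat) (u : 'rV[R]_n) :
  norm2 u ^+ 2 = dotp u u.
Proof. by rewrite sqr_sqrtr ?dotp_ge0. Qed.

Lemma norm2Z (R : realType) (n : nat) (a : R) (u : 'rV[R]_n) :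
  norm2 (a *: u) = `|a| * norm2 u.
Proof.
by rewrite /norm2 dotpZl dotpZr mulrA -expr2 sqrtrM ?sqr_ge0 ?sqrtr_sqr.
Qed.

Lemma coord_le_norm2 (R : realType) (n : nat) (u : 'rV[R]_n) (i : 'I_n) :
  `|u 0 i| <= norm2 u.
Proof.
rewrite -sqrtr_sqr ler_wsqrtr // /dotp (bigD1 i) //= -expr2 lerDl.
by apply: sumr_ge0 => k _; rewrite -expr2 sqr_ge0.
Qed.

Lemma norm2_eq0 (R : realType) (n : nat) (u : 'rV[R]_n) :
  norm2 u = 0 -> u = 0.
Proof.
move=> u0; apply/rowP => i; rewrite mxE; apply/eqP.
by rewrite -normr_le0 -u0 coord_le_norm2.
Qed.

Lemma norm2_normalize (R : realType) (n : nat) (u : 'rV[R]_n) :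
  norm2 u != 0 -> norm2 ((norm2 u)^-1 *: u) = 1.
Proof.
by move=> u0; rewrite norm2Z ger0_norm ?invr_ge0 ?norm2_ge0 ?mulVf.
Qed.

(** The matrix [V] with rows [v i] satisfies [V *m V^T = 1]; being square, it
    also satisfies [V^T *m V = 1], which is Parseval. *)
Lemma parseval (R : realType) (n : nat) (v : 'I_n -> 'rV[R]_n)
    (x : 'rV[R]_n) :
  (forall i j, dotp (v i) (v j) = (i == j)%:R) ->
  \sum_(i < n) dotp x (v i) ^+ 2 = dotp x x.
Proof.
move=> hv; pose V := \matrix_(i < n) v i.
have VVt : V *m V^T = 1%:M.
  apply/matrixP => i j; rewrite !mxE -hv; apply: eq_bigr => k _.
  by rewrite !mxE.
have dotpE (u w : 'rV[R]_n) : dotp u w = (u *m w^T) 0 0.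
  by rewrite mxE; apply: eq_bigr => k _; rewrite mxE.
have -> : dotp x x = dotp (x *m V^T) (x *m V^T).
  by rewrite !dotpE trmx_mul trmxK mulmxA -(mulmxA x) (mulmx1C VVt) mulmx1.
apply: eq_bigr => i _; rewrite expr2; congr (_ * _);
  by rewrite mxE; apply: eq_bigr => k _; rewrite !mxE.
Qed.

(** * Multilinear forms and the operator norm *)

Lemma tensor_formD (R : realType) (p n : nat) (A B : tensor R p n)
    (x : 'I_p -> 'rV[R]_n) :
  tensor_form (A + B) x = tensor_form A x + tensor_form B x.
Proof. by rewrite -big_split; apply: eq_bigr => i _; rewrite ffunE mulrDl. Qed.

Lemma tensor_formZ (R : realType) (p n : nat) (A : tensor R p n)
    (a : 'I_p -> R) (x : 'I_p -> 'rV[R]_n) :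
  tensor_form A (fun k => a k *: x k) = (\prod_(k < p) a k) * tensor_form A x.
Proof.
rewrite /tensor_form mulr_sumr; apply: eq_bigr => i _.
rewrite mulrCA -big_split; congr (_ * _).
by apply: eq_bigr => k _; rewrite mxE.
Qed.

Lemma tensor_diagZ (R : realType) (p n : nat) (A : tensor R p n)
    (a : R) (x : 'rV[R]_n) :
  tensor_diag A (a *: x) = a ^+ p * tensor_diag A x.
Proof.
by rewrite /tensor_diag (tensor_formZ A (fun=> a)) prodr_const card_ord.
Qed.

Lemma tensor_form_pow (R : realType) (p n : nat) (u : 'rV[R]_n)
    (x : 'I_p -> 'rV[R]_n) :
  tensor_form (tensor_pow p u) x = \prod_(k < p) dotp (x k) u.
Proof.
rewrite /dotp bigA_distr_bigA; apply: eq_bigr => i _.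
by rewrite ffunE -big_split; apply: eq_bigr => k _; rewrite mulrC.
Qed.

Lemma tensor_form_odeco (R : realType) (p n : nat) (lambda : 'I_n -> R)
    (v : 'I_n -> 'rV[R]_n) (x : 'I_p -> 'rV[R]_n) :
  tensor_form (\sum_(i < n) lambda i *: tensor_pow p (v i)) x =
  \sum_(i < n) lambda i * \prod_(k < p) dotp (x k) (v i).
Proof.
under [RHS]eq_bigr do rewrite -tensor_form_pow /tensor_form mulr_sumr.
rewrite exchange_big; apply: eq_bigr => s _.
rewrite sum_ffunE mulr_suml; apply: eq_bigr => i _.
by rewrite ffunE mulrA.
Qed.

(** A supremum is only an upper bound of a bounded set: here the sum of the
    absolute values of the entries bounds the form, because the coordinates of
    a unit vector lie in [[-1, 1]]. *)
Lemma tensor_form_le_opnorm (R : realType) (p n : nat) (A : tensor R p n)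
    (x : 'I_p -> 'rV[R]_n) :
  (forall k, norm2 (x k) = 1) -> tensor_form A x <= opnorm A.
Proof.
move=> x1; apply: ub_le_sup; last by exists x.
exists (\sum_i `|A i|) => _ [y y1 <-]; apply: ler_sum => i _.
apply: le_trans (ler_norm _) _; rewrite normrM ler_piMr // normr_prod.
apply: prodr_ile1 => k _.
by rewrite normr_ge0 -(y1 k) coord_le_norm2.
Qed.

(** By multilinearity it is enough to treat unit vectors. The supremum defining
    [opnorm] is one-sided; the lower bound follows by changing the sign of one
    argument, which is where [0 < p] enters. *)
Lemma tensor_form_norm_le (R : realType) (p n : nat) (A : tensor R p n)
    (x : 'I_p -> 'rV[R]_n) :
  (0 < p)%N -> `|tensor_form A x| <= opnorm A * \prod_(k < p) norm2 (x k).
Proof.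
move=> p0.
have [/existsP[k /eqP xk0]|] := boolP [exists k, norm2 (x k) == 0].
  rewrite [X in `|X| <= _]big1 => [|i _].
    by rewrite normr0 (bigD1 k) //= xk0 mul0r mulr0.
  by rewrite (bigD1 k) //= (norm2_eq0 xk0) mxE mul0r mulr0.
rewrite negb_exists => /forallP x0.
have -> : tensor_form A x = (\prod_(k < p) norm2 (x k)) *
    tensor_form A (fun k => (norm2 (x k))^-1 *: x k).
  rewrite -tensor_formZ; congr tensor_form; apply/funext => k.
  by rewrite scalerA divff ?scale1r.
have xge0 : 0 <= \prod_(k < p) norm2 (x k).
  by apply: prodr_ge0 => k _; exact: norm2_ge0.
rewrite normrM ger0_norm // mulrC ler_wpM2r // ler_norml.
have u1 k : norm2 ((norm2 (x k))^-1 *: x k) = 1 by rewrite norm2_normalize.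
rewrite tensor_form_le_opnorm // andbT lerNl.
(* Negate the first argument only: this flips the sign for any [p]. *)
pose a k : R := if k == Ordinal p0 then -1 else 1.
have -> : - tensor_form A (fun k => (norm2 (x k))^-1 *: x k) =
    tensor_form A (fun k => a k *: ((norm2 (x k))^-1 *: x k)).
  rewrite (tensor_formZ _ a) (bigD1 (Ordinal p0)) //= big1 => [|k /negPf k0].
    by rewrite /a eqxx mulr1 mulN1r.
  by rewrite /a k0.
apply: tensor_form_le_opnorm => k.
by rewrite norm2Z u1 mulr1 /a; case: ifP; rewrite ?normrN normr1.
Qed.

(** * First-order condition on the sphere *)

Lemma deriv_prod_ord (R : comNzRingType) (p : nat) (F : 'I_p -> {poly R}) :
  (\prod_(k < p) F k)^`() =
  \sum_(k < p) \prod_(l < p) (if l == k then (F l)^`() else F l).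
Proof.
elim: p F => [|p IHp] F; first by rewrite !big_ord0 derivE.
rewrite !big_ord_recl derivM IHp mulr_sumr /=; congr (_ + _).
by apply: eq_bigr => k _; rewrite big_ord_recl.
Qed.

(** Write [P = 'X * (b + 'X * S)] with [b] the derivative at 0. If [b] were
    nonzero, a short step against its sign would make [P] negative, because [S]
    is bounded on the unit disk. *)
Lemma deriv_at_min0 (R : realFieldType) (P : {poly R}) :
  P.[0] = 0 -> (forall t, 0 <= P.[t]) -> P^`().[0] = 0.
Proof.
move=> P0 Pge0.
have /factor_theorem[Q PE] : root P 0 by apply/eqP.
have Q0 : P^`().[0] = Q.[0].
  by rewrite PE derivM derivXsubC !hornerE oppr0 mulr0 add0r.
have /factor_theorem[S SE] : root (Q - Q.[0]%:P) 0.
  by rewrite /root !hornerE subrr.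
have PtE t : P.[t] = t * (Q.[0] + t * S.[t]).
  have -> : Q.[0] + t * S.[t] = Q.[t].
    have := congr1 (fun q => q.[t]) SE; rewrite !hornerE subr0 => /eqP.
    by rewrite subr_eq addrC mulrC => /eqP.
  by rewrite PE !hornerE subr0 mulrC.
have [B SB] := poly_disk_bound S 1.
have B0 : 0 <= B by apply: le_trans (SB 0 _); rewrite ?normr0.
rewrite Q0; set b := Q.[0] in PtE *; apply/eqP/negPn/negP => b0.
have bpos : 0 < `|b| by rewrite normr_gt0.
(* With this [D], the step [- b / D] stays in the unit disk and [B < D]. *)
pose D := `|b| + B + 1; have D0 : 0 < D by rewrite /D; lra.
have t1 : `|- b / D| <= 1.
  by rewrite normrM normrN normfV (gtr0_norm D0) ler_pdivrMr // /D; lra.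
have := Pge0 (- b / D); rewrite PtE.
have -> : - b / D * (b + - b / D * S.[- b / D]) =
  (b / D) ^+ 2 * (S.[- b / D] - D) by field; rewrite gt_eqF.
have bD0 : 0 < (b / D) ^+ 2.
  by rewrite exprn_even_gt0 //= mulf_neq0 ?invr_eq0 ?(gt_eqF D0).
rewrite pmulr_rge0 //.
by have := SB _ t1; rewrite ler_norml /D => /andP[_]; lra.
Qed.

Lemma tensor_diag_le_norm2 (R : realType) (p n : nat) (A : tensor R p n)
    (x z : 'rV[R]_n) :
  argmax (@unit_sphere R n) (tensor_diag A) x -> norm2 z != 0 ->
  tensor_diag A z <= tensor_diag A x * norm2 z ^+ p.
Proof.
move=> [_ xmax] z0.
have -> : tensor_diag A z =
    norm2 z ^+ p * tensor_diag A ((norm2 z)^-1 *: z).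
  by rewrite -tensor_diagZ scalerA divff ?scale1r.
rewrite mulrC ler_wpM2r ?exprn_ge0 ?norm2_ge0 //.
by apply: xmax; exact: norm2_normalize.
Qed.

(** Along the line [x + t *: w] tangent to the sphere, homogeneity bounds the
    form by its maximal value [L] times the [p]-th power of the norm, where the
    squared norm is [1 + b * t ^+ 2]. So the form exceeds [L] by [O(t ^+ 2)]
    only, and its derivative at [t = 0] vanishes. That derivative is the sum,
    over the slots, of the form with [w] in one slot and [x] in the others. *)
Lemma argmax_stationary (R : realType) (p n : nat) (A : tensor R p n)
    (x w : 'rV[R]_n) :
  argmax (@unit_sphere R n) (tensor_diag A) x -> dotp x w = 0 ->
  \sum_(k < p) tensor_form A (fun l => if l == k then w else x) = 0.
Proof.
move=> xmax xw0; have x1 : dotp x x = 1 by rewrite -sqr_norm2 xmax.1 expr1n.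
pose L := tensor_diag A x; pose b := dotp w w.
pose F (i : {ffun 'I_p -> 'I_n}) k := (x 0 (i k))%:P + w 0 (i k) *: 'X.
pose Q := \sum_i A i *: \prod_(k < p) F i k.
pose M := (1 + b *: 'X^2) ^+ p : {poly R}.
(* The norm [N] is not polynomial in [t], so [N ^+ p] is replaced by the larger
   [N ^+ (2 * p)]; the factor [`|L|] makes the comparison valid for either sign
   of [L]. *)
pose P := L%:P + `|L| *: (M - 1) - Q.
have Qt t : Q.[t] = tensor_diag A (x + t *: w).
  rewrite /Q horner_sum; apply: eq_bigr => i _.
  rewrite hornerZ horner_prod; congr (_ * _); apply: eq_bigr => k _.
  by rewrite /F !hornerE !mxE mulrC.
have dQ : Q^`().[0] =
    \sum_(k < p) tensor_form A (fun l => if l == k then w else x).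
  rewrite /Q raddf_sum horner_sum exchange_big /=; apply: eq_bigr => i _.
  rewrite derivZ hornerZ deriv_prod_ord horner_sum mulr_sumr.
  apply: eq_bigr => k _; rewrite horner_prod; congr (_ * _).
  by apply: eq_bigr => l _; case: ifP => _; rewrite /F !(derivE, hornerE).
have Mt t : M.[t] = (1 + b * t ^+ 2) ^+ p.
  by rewrite /M horner_exp hornerD hornerZ hornerXn hornerC.
have dM : M^`().[0] = 0.
  rewrite /M deriv_exp derivD derivC derivZ derivXn add0r hornerMn hornerM.
  by rewrite hornerZ hornerMn hornerX mul0rn mulr0 mul0r mul0rn.
have Pt t : P.[t] = L + `|L| * ((1 + b * t ^+ 2) ^+ p - 1) -
    tensor_diag A (x + t *: w).
  by rewrite /P !hornerD !hornerN hornerZ hornerD hornerN !hornerC Mt Qt.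
have P0 : P.[0] = 0.
  by rewrite Pt scale0r addr0 expr0n mulr0 addr0 expr1n subrr mulr0 addr0 subrr.
have dP : P^`().[0] = - Q^`().[0].
  rewrite /P derivB derivD derivC derivZ derivB derivC subr0 add0r.
  by rewrite hornerD hornerN hornerZ dM mulr0 add0r.
have Pge0 t : 0 <= P.[t].
  pose N := norm2 (x + t *: w).
  have b0 : 0 <= b by exact: dotp_ge0.
  have N2 : N ^+ 2 = 1 + b * t ^+ 2.
    rewrite sqr_norm2 dotpDl !(dotpC _ (_ + _)) !dotpDl !dotpZl !dotpZr.
    rewrite (dotpC w x) xw0 x1 -/b; ring.
  have tb0 : 0 <= b * t ^+ 2 by rewrite mulr_ge0 ?sqr_ge0.
  have N1 : 1 <= N.
    by rewrite -(@ler_pXn2r _ 2) ?nnegrE ?norm2_ge0 // expr1n N2; lra.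
  have NM : N ^+ p <= (1 + b * t ^+ 2) ^+ p.
    rewrite -N2 lerXn2r ?nnegrE ?sqr_ge0 ?norm2_ge0 //.
    by rewrite expr2 ler_peMl //; lra.
  have Np : 1 <= N ^+ p by exact: exprn_ege1.
  have N0 : N != 0 by rewrite gt_eqF //; lra.
  rewrite Pt subr_ge0.
  apply: le_trans (tensor_diag_le_norm2 xmax N0) _; rewrite -/L -/N.
  have : L * (N ^+ p - 1) <= `|L| * ((1 + b * t ^+ 2) ^+ p - 1).
    apply: le_trans (_ : `|L| * (N ^+ p - 1) <= _).
      by rewrite ler_wpM2r ?ler_norm // subr_ge0.
    by rewrite ler_wpM2l // lerB.
  by lra.
by apply/eqP; rewrite -dQ -oppr_eq0 -dP deriv_at_min0.
Qed.

(** * The error bound *)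

(** The distance between two unit vectors with inner product [c] is
    [Num.sqrt (2 - 2 * c)]. With [e = eps / a] there are three ranges.
    For [e >= 1/5] the diameter 2 is at most [10 * e]. Below, [c >= 1 - 2 * e],
    so the squared distance is at most [4 * e], which is at most
    [(10 * e) ^+ 2] as long as [e >= 1/25]. For [e < 1/25] the same bound gives
    [s <= 2/5], and the last hypothesis then improves it to a linear one. *)
Lemma chord_le_of_stationary (R : realType) (a eps c q s : R) :
  0 < a -> 0 <= eps -> 0 <= s -> s ^+ 2 = 1 - c ^+ 2 ->
  a - 2 * eps <= a * q -> (0 < q -> q <= c) ->
  (0 < c -> c * s ^+ 2 * (a * q - (a * q + 2 * eps) * s) <= eps * s) ->
  Num.sqrt (2 - 2 * c) <= 10 * (eps / a + (eps / a) ^+ 2).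
Proof.
move=> a0 eps0 s0 sc; set e := eps / a.
have -> : eps = a * e by rewrite /e mulrCA divff ?mulr1 // gt_eqF.
have e0 : 0 <= e by rewrite divr_ge0 // ltW.
have -> : a - 2 * (a * e) = a * (1 - 2 * e) by ring.
have -> : c * s ^+ 2 * (a * q - (a * q + 2 * (a * e)) * s) =
  a * (c * s ^+ 2 * (q - (q + 2 * e) * s)) by ring.
rewrite -(mulrA a e) !ler_pM2l // => q12 qc stat.
have c1 : c <= 1 by nra.
suff d : 2 - 2 * c <= (10 * e) ^+ 2.
  have e2 : 0 <= e ^+ 2 by exact: sqr_ge0.
  apply: le_trans (_ : 10 * e <= _); last lra.
  have e10 : 0 <= 10 * e by lra.
  by rewrite -(ger0_norm e10) -sqrtr_sqr ler_wsqrtr.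
have [e5|e5] := lerP (1 / 5) e.
  have : - 1 <= c by have := sqr_ge0 s; nra.
  by nra.
have {}qc : q <= c by apply: qc; lra.
have {}stat : c * s ^+ 2 * (q - (q + 2 * e) * s) <= e * s by apply: stat; lra.
have [e25|e25] := lerP (1 / 25) e; first nra.
have s4 : s <= 2 / 5 by nra.
have [s_eq0|s_neq0] := eqVneq s 0.
  have : c ^+ 2 = 1 by move: sc; rewrite s_eq0 expr0n /=; lra.
  by nra.
have s_gt0 : 0 < s by rewrite lt_def s_neq0.
have split_s : c * s ^+ 2 * (q - (q + 2 * e) * s) =
  c * s * (q - (q + 2 * e) * s) * s by ring.
rewrite split_s ler_pM2r // in stat.
(* From [1 - 2 * e >= 23/25]: the gap is at least [23/25 * 3/5 - 2/25 * 2/5]. *)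
have gap : 13 / 25 <= q - (q + 2 * e) * s by nra.
have cs : (23 / 25) * s <= c * s by rewrite ler_wpM2r //; lra.
have se : s <= 3 * e.
  suff : (23 / 25) * s * (13 / 25) <= e by lra.
  apply: le_trans stat; apply: ler_pM => //; lra.
have : 1 - c <= s ^+ 2 by rewrite sc; nra.
have : s ^+ 2 <= (3 * e) ^+ 2 by rewrite lerXn2r ?nnegrE // mulr_ge0.
by rewrite !exprMn; have := sqr_ge0 e; lra.
Qed.

Lemma expr_le_norm (R : realDomainType) (c : R) (m : nat) :
  (0 < m)%N -> `|c| <= 1 -> c ^+ m <= `|c|.
Proof.
case: m => // m _ c1; apply: le_trans (ler_norm _) _.
by rewrite normrX exprS ler_piMr // exprn_ile1.
Qed.

Theorem theorem2p2 (R : realType) (p n : nat) (hp3 : (3 <= p)%N) (hpodd : odd p)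
    (T E That : tensor R p n) (hThat : That = T + E)
    (lambda : 'I_n -> R) (v : 'I_n -> 'rV[R]_n)
    (hTsym : symmetric_tensor T)
    (hT : T = \sum_(i < n) lambda i *: tensor_pow p (v i))
    (hv : orthonormal_basis v)
    (hlambda : forall i, 0 < lambda i)
    (hEsym : symmetric_tensor E)
    (eps : R) (heps : eps = opnorm E)
    (xhat : 'rV[R]_n)
    (hxhat : argmax (@unit_sphere R n) (tensor_diag That) xhat)
    (lambdahat : R) (hlambdahat : lambdahat = tensor_diag That xhat) :
  exists j : 'I_n,
    `|lambdahat - lambda j| <= eps /\
    norm2 (xhat - v j) <= 10 * (eps / lambda j + (eps / lambda j) ^+ 2).
Proof.
have [m m_odd pE] : exists2 m, odd m & p = m.+2.
  case: p hp3 hpodd {T E That hThat hTsym hT hEsym heps hxhat hlambdahat}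
    => [|[|m]] // _; rewrite /= negbK; by exists m.
have m_gt0 : (0 < m)%N by rewrite odd_gt0.
have p_gt0 : (0 < p)%N by rewrite pE.
have [vv _] := hv.
pose x := xhat; have x1 : norm2 x = 1 := hxhat.1.
have xx1 : dotp x x = 1 by rewrite -sqr_norm2 x1 expr1n.
pose c i := dotp x (v i).
have c2 : \sum_i c i ^+ 2 = 1 by rewrite (parseval _ vv).
have v1 i : norm2 (v i) = 1 by rewrite /norm2 vv eqxx sqrtr1.
have E_le (y : 'rV[R]_n) : norm2 y = 1 -> `|tensor_diag E y| <= eps.
  move=> y1; rewrite heps; have := tensor_form_norm_le E (fun=> y) p_gt0.
  by rewrite y1 prodr_const expr1n mulr1.
have eps_ge0 : 0 <= eps by apply: le_trans (E_le _ x1).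
have T_diag y : tensor_diag T y = \sum_i lambda i * dotp y (v i) ^+ p.
  rewrite hT /tensor_diag tensor_form_odeco; apply: eq_bigr => i _.
  by rewrite prodr_const card_ord.
have lambda_le i : lambda i - eps <= lambdahat.
  have := hxhat.2 (v i) (v1 i); rewrite -hlambdahat; apply: le_trans.
  rewrite hThat /tensor_diag tensor_formD -!/(tensor_diag _ _) T_diag.
  rewrite (bigD1 i) //= vv eqxx expr1n mulr1 big1 => [|k /negPf ki].
    by have := E_le _ (v1 i); rewrite ler_norml => /andP[+ _]; lra.
  by rewrite vv eq_sym ki expr0n gtn_eqF // mulr0.
have lhat_le : lambdahat - eps <= \sum_i lambda i * c i ^+ p.
  rewrite hlambdahat hThat /tensor_diag tensor_formD -!/(tensor_diag _ _).
  by rewrite T_diag; have := E_le _ x1; rewrite ler_norml => /andP[_]; lra.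
have [i0 _] : exists i0 : 'I_n, True.
  have [n0|n_gt0] := posnP n; last by exists (Ordinal n_gt0).
  have := c2; rewrite big1 => [/esym/eqP|[i lt_in]]; first by rewrite oner_eq0.
  by exfalso; rewrite n0 in lt_in.
pose j := [arg max_(i > i0) (lambda i * c i ^+ m)]%O.
have jmax i : lambda i * c i ^+ m <= lambda j * c j ^+ m.
  by rewrite /j; case: arg_maxP => //= k _; exact.
have split_p i : lambda i * c i ^+ p = lambda i * c i ^+ m * c i ^+ 2.
  by rewrite -mulrA -exprD addn2 pE.
set q := c j ^+ m in jmax.
have lhat_q : lambdahat - eps <= lambda j * q.
  apply: le_trans lhat_le _; rewrite -[leRHS]mulr1 -c2 mulr_sumr.
  by apply: ler_sum => i _; rewrite split_p ler_wpM2r ?sqr_ge0.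
have c_le1 i : `|c i| <= 1.
  rewrite -(@ler_pXn2r _ 2) ?nnegrE // real_normK ?num_real // expr1n -c2.
  by rewrite (bigD1 i) //= lerDl; apply: sumr_ge0 => k _; exact: sqr_ge0.
have q_le1 : q <= 1 by apply: le_trans (expr_le_norm m_gt0 (c_le1 j)) _.
exists j; split.
  rewrite ler_norml; have := lambda_le j.
  have : lambda j * q <= lambda j by rewrite ler_piMr // ltW.
  by move=> ? ?; apply/andP; split; lra.
(* Direction of steepest increase of the inner product with [v j] within the
   tangent space of the sphere at [x]. *)
pose w := v j - c j *: x.
have xw : dotp x w = 0 by rewrite dotpBr dotpZr xx1 mulr1 subrr.
have wv i : dotp w (v i) = (j == i)%:R - c j * c i.
  by rewrite dotpBl dotpZl vv.
have s2 : norm2 w ^+ 2 = 1 - c j ^+ 2.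
  rewrite sqr_norm2 {2}/w dotpBr dotpZr (dotpC w x) xw mulr0 subr0.
  by rewrite wv eqxx -expr2.
set s := norm2 w in s2; have s_ge0 : 0 <= s by exact: norm2_ge0.
have form_T (k : 'I_p) : tensor_form T (fun l => if l == k then w else x) =
    \sum_i lambda i * (c i ^+ m.+1 * dotp w (v i)).
  rewrite hT tensor_form_odeco; apply: eq_bigr => i _; congr (_ * _).
  rewrite (bigD1 k) //= eqxx mulrC; congr (_ * _).
  rewrite (eq_bigr (fun=> c i)) => [|l /negPf -> //].
  by rewrite prodr_const cardC1 card_ord pE.
have form_E (k : 'I_p) :
    - (eps * s) <= tensor_form E (fun l => if l == k then w else x).
  have := tensor_form_norm_le E (fun l => if l == k then w else x) p_gt0.
  rewrite (bigD1 k) //= eqxx big1 => [|l /negPf -> //].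
  by rewrite mulr1 -heps ler_norml => /andP[].
have T_le : \sum_i lambda i * (c i ^+ m.+1 * dotp w (v i)) <= eps * s.
  (* The [p] slots give equal contributions of [T], and each one of [E] is at
     least [- (eps * s)]. *)
  have := argmax_stationary hxhat xw; rewrite hThat.
  under eq_bigr do rewrite tensor_formD form_T.
  rewrite big_split sumr_const card_ord /=.
  have : \sum_(k < p) - (eps * s) <=
      \sum_(k < p) tensor_form E (fun l => if l == k then w else x).
    by apply: ler_sum => k _; exact: form_E.
  rewrite sumr_const card_ord => Ek Tk.
  move/eqP: Tk; rewrite addr_eq0 => /eqP Tk.
  by rewrite -(ler_pMn2r p_gt0) Tk lerNl -mulNrn.
have -> : norm2 (xhat - v j) = Num.sqrt (2 - 2 * c j).
  rewrite /norm2 dotpBl !dotpBr -/x xx1 vv eqxx (dotpC _ x) -/(c j).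
  by congr Num.sqrt => /=; ring.
apply: (@chord_le_of_stationary _ (lambda j) eps (c j) q s) => //.
- by have := lambda_le j; lra.
- rewrite /q exprn_odd_gt0 // => cj_gt0.
  by apply: le_trans (expr_le_norm m_gt0 (c_le1 j)) _; rewrite gtr0_norm.
have c_le_s i : i != j -> `|c i| <= s.
  move=> ij; rewrite -(@ler_pXn2r _ 2) ?nnegrE // real_normK ?num_real // s2.
  rewrite -c2 (bigD1 j) //= addrAC subrr add0r (bigD1 i) //= lerDl.
  by apply: sumr_ge0 => k _; exact: sqr_ge0.
move=> cj_gt0; apply: le_trans T_le.
(* The contribution to the value of [T] of the components other than [j]. *)
pose r := \sum_(i < n | i != j) lambda i * c i ^+ p.
have r_le : r <= (lambda j * q + 2 * eps) * s * s ^+ 2.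
  have -> : s ^+ 2 = \sum_(i < n | i != j) c i ^+ 2.
    by rewrite s2 -c2 (bigD1 j) //= addrAC subrr add0r.
  rewrite /r mulr_sumr; apply: ler_sum => i ij.
  rewrite split_p ler_wpM2r ?sqr_ge0 //.
  apply: le_trans (_ : lambda i * s <= _).
    rewrite ler_pM2l //; apply: le_trans (expr_le_norm m_gt0 (c_le1 i)) _.
    exact: c_le_s.
  by rewrite ler_wpM2r //; have := lambda_le i; lra.
have -> : \sum_i lambda i * (c i ^+ m.+1 * dotp w (v i)) =
    c j * (lambda j * q * s ^+ 2 - r).
  have -> : r = \sum_i lambda i * c i ^+ p - lambda j * q * c j ^+ 2.
    by rewrite [\sum_i _](bigD1 j) //= split_p addrAC subrr add0r.
  rewrite s2; under eq_bigr => i _.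
    have -> : lambda i * (c i ^+ m.+1 * dotp w (v i)) =
        (if i == j then lambda j * q * c j else 0) -
        c j * (lambda i * c i ^+ p).
      rewrite wv split_p exprSr (eq_sym j).
      by case: eqP => [->|_]; rewrite /q /=; ring.
    over.
  rewrite sumrB -mulr_sumr -big_mkcond big_pred1_eq; ring.
rewrite -mulrA ler_pM2l //; lra.
Qed.
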